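(* For any $P,N>0$, $$\overline{C}_{\mathrm{LD}}(P,N)\coloneqq\lim_{L\to\infty}\overline{C}_{L-1}(P,N)=\frac{1}{2}\ln\frac{P}{N}.$$
   Context: For $r>0$ and $y\in\mathbb{R}^n$, $\mathcal{B}^n(y,r)$ denotes the closed Euclidean ball of radius $r$ centered at $y$, and $\mathcal{B}^n(r)=\mathcal{B}^n(0,r)$. For points $x_1,\dots,x_L\in\mathbb{R}^n$ with centroid $\bar x=\frac1L\sum_i x_i$, the average squared radius is $\overline{\mathrm{rad}}^2(x_1,\dots,x_L)=\frac1L\sum_{i=1}^L\|x_i-\bar x\|_2^2$. Let $P,N>0$ and $L\in\mathbb{Z}_{\ge 2}$. A finite set $\mathcal{C}\subseteq\mathcal{B}^n(\sqrt{nP})$ is a $(P,N,L-1)$-average-radius list-decodable code if every $L$ distinct points of $\mathcal{C}$ have average squared radius strictly greater than $nN$. The rate of $\mathcal{C}$ is $R(\mathcal{C})=\frac1n\ln|\mathcal{C}|$. The $(P,N,L-1)$-average-radius list-decoding capacity is $\overline{C}_{L-1}(P,N)=\limsup_{n\to\infty}\sup\{R(\mathcal{C})\}$, the supremum over all $(P,N,L-1)$-average-radius list-decodable codes $\mathcal{C}\subseteq\mathcal{B}^n(\sqrt{nP})$.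
   Formalization: The limit is stated as max(0, ½ ln(P/N)) instead of ½ ln(P/N): for P < N the printed formula is negative, while one-point codes have rate 0, so the capacity is 0; for P ≥ N the two formulas agree. *)

(* Defs.v *)
From HB Require Import structures.
From mathcomp Require Import all_boot all_order all_algebra.
From mathcomp Require Import all_classical all_reals all_analysis.
Set Implicit Arguments. Unset Strict Implicit. Unset Printing Implicit Defensive.
Import Order.TTheory GRing.Theory Num.Theory.
Local Open Scope ring_scope.
Local Open Scope classical_set_scope.

Section Defs.
Variable R : realType.

Definition sqnorm (n : nat) (x : 'rV[R]_n) : R := \sum_(i < n) x ord0 i ^+ 2.

Definition centroid (n : nat) (s : seq 'rV[R]_n) : 'rV[R]_n :=
  (size s)%:R^-1 *: \sum_(x <- s) x.

Definition avg_sq_rad (n : nat) (s : seq 'rV[R]_n) : R :=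
  (size s)%:R^-1 * \sum_(x <- s) sqnorm (x - centroid s).

(* C (a duplicate-free list, i.e. a finite set) is a (P,N,L-1)-average-radius
   list-decodable code in B^n(sqrt(nP)) *)
Definition avg_rad_LD_code (P N : R) (L n : nat) (C : seq 'rV[R]_n) : Prop :=
  uniq C /\
  (forall x, x \in C -> sqnorm x <= n%:R * P) /\
  (forall s : seq 'rV[R]_n, uniq s -> size s = L -> {subset s <= C} ->
     avg_sq_rad s > n%:R * N).

Definition rate (n : nat) (C : seq 'rV[R]_n) : R := ln (size C)%:R / n%:R.

Definition best_rate (P N : R) (L n : nat) : \bar R :=
  ereal_sup [set (rate C)%:E | C in [set C : seq 'rV[R]_n | avg_rad_LD_code P N L C]].

Definition avg_rad_LD_capacity (P N : R) (L : nat) : \bar R :=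
  limn_esup (best_rate P N L).

End Defs.

(* Main.v *)
Require Import Defs.
From HB Require Import structures.
From mathcomp Require Import all_boot all_order all_algebra.
From mathcomp Require Import all_classical all_reals all_analysis.
From mathcomp Require Import perm ring lra zify.
Set Implicit Arguments. Unset Strict Implicit. Unset Printing Implicit Defensive.
Import Order.TTheory GRing.Theory Num.Theory.
Import numFieldNormedType.Exports.
Local Open Scope ring_scope.

(** Volumes are replaced by numbers of integer points. With [nrm x = |x| / sqrt n], let [f a]
    be the number of [z] in [Z^n] with [nrm z <= a]. Writing integer vectors in base [b] gives
    [b^n f(a-1) <= f(ab) <= a^n f(b+1)], so that for large radii [f a / f b] is [(a/b)^n] up to
    an arbitrarily small exponential factor.

    Upper bound ([N < P]): every point [x] of the ball of radius [sqrt (nP)] is within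
    [sqrt (nN)] of a fraction about [(N/P)^(n/2)] of the points of a fine grid in the ball of
    radius [sqrt (n(P-N))]. Each grid point is that close to fewer than [L] codewords, since
    otherwise [L] of them would have average squared radius at most [nN].

    Lower bound: draw codewords uniformly from a fine grid in the ball of radius [sqrt (nP)].
    If [L] of them have average squared radius at most [nN], round their centroid to a
    grid point [y] and their distances to [y] up to multiples of the mesh. For a fixed outcome
    of the rounding, AM-GM bounds the probability by about [(N/P)^(nL/2)]. There are only
    exponentially many choices of [y], a cost that disappears from the rate as [L] grows. *)

(** * Euclidean geometry with the dimension-normalized norm *)

Section Euclidean.
Variables (R : realType) (n : nat).
Implicit Types (x y z : 'rV[R]_n) (a c t : R).

Definition dotp x y : R := \sum_(i < n) x ord0 i * y ord0 i.

(** The normalization keeps radii free of the dimension: the ball of squared radius [n P] becomes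
    [nrm x <= sqrt P], and rounding to integer coordinates moves a vector by at most [1]. *)
Definition nrm x : R := Num.sqrt (sqnorm x / n%:R).

Lemma sqnorm_ge0 x : 0 <= sqnorm x.
Proof. by apply: sumr_ge0 => i _; rewrite sqr_ge0. Qed.

Lemma sqnorm0 : sqnorm (0 : 'rV[R]_n) = 0.
Proof. by rewrite /sqnorm big1 // => i _; rewrite mxE expr0n. Qed.

Lemma sqnormZ c x : sqnorm (c *: x) = c ^+ 2 * sqnorm x.
Proof. by rewrite /sqnorm mulr_sumr; apply: eq_bigr => i _; rewrite mxE exprMn. Qed.

Lemma sqnormD x y : sqnorm (x + y) = sqnorm x + 2 * dotp x y + sqnorm y.
Proof.
rewrite /sqnorm /dotp mulr_sumr -!big_split /=; apply: eq_bigr => i _.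
by rewrite mxE; ring.
Qed.

Lemma dotpZl c x y : dotp (c *: x) y = c * dotp x y.
Proof. by rewrite /dotp mulr_sumr; apply: eq_bigr => i _; rewrite mxE mulrA. Qed.

Lemma dotpZr c x y : dotp x (c *: y) = c * dotp x y.
Proof. by rewrite /dotp mulr_sumr; apply: eq_bigr => i _; rewrite mxE mulrCA. Qed.

Lemma sqnormN x : sqnorm (- x) = sqnorm x.
Proof. by rewrite -scaleN1r sqnormZ sqrrN expr1n mul1r. Qed.

Lemma dotp_CS x y : dotp x y ^+ 2 <= sqnorm x * sqnorm y.
Proof.
have [y0|y0] := eqVneq (sqnorm y) 0.
  have y00 i : y ord0 i = 0.
    apply/eqP; rewrite -sqrf_eq0; apply/eqP.
    by apply: (psumr_eq0P (P := xpredT) (F := fun i => y ord0 i ^+ 2)) => // j _;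
      rewrite sqr_ge0.
  rewrite /dotp big1 ?expr0n ?mulr_ge0 ?sqnorm_ge0 //= => i _.
  by rewrite y00 mulr0.
have yp : 0 < sqnorm y by rewrite lt_neqAle eq_sym y0 sqnorm_ge0.
have := sqnorm_ge0 (sqnorm y *: x + (- dotp x y) *: y).
rewrite sqnormD !sqnormZ dotpZl dotpZr => h.
rewrite -subr_ge0 -(pmulr_rge0 _ yp); apply: le_trans h _.
by rewrite le_eqVlt; apply/orP; left; apply/eqP; ring.
Qed.

Lemma nrm_ge0 x : 0 <= nrm x. Proof. exact: sqrtr_ge0. Qed.

Lemma nrm_sqr x : nrm x ^+ 2 = sqnorm x / n%:R.
Proof. by rewrite sqr_sqrtr // divr_ge0 ?sqnorm_ge0. Qed.

Lemma sqnormE x : (0 < n)%N -> sqnorm x = n%:R * nrm x ^+ 2.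
Proof. by move=> n0; rewrite nrm_sqr mulrC divfK // pnatr_eq0 -lt0n. Qed.

Lemma nrmN x : nrm (- x) = nrm x.
Proof. by rewrite /nrm sqnormN. Qed.

Lemma nrmZ c x : nrm (c *: x) = `|c| * nrm x.
Proof. by rewrite /nrm sqnormZ -mulrA sqrtrM ?sqr_ge0 // sqrtr_sqr. Qed.

Lemma nrm_le x a : 0 <= a -> (nrm x <= a) = (sqnorm x / n%:R <= a ^+ 2).
Proof. by move=> a0; rewrite -nrm_sqr ler_pXn2r ?nnegrE ?nrm_ge0. Qed.

Lemma nrmD x y : nrm (x + y) <= nrm x + nrm y.
Proof.
have h : dotp x y / n%:R <= nrm x * nrm y.
  apply: le_trans (ler_norm _) _.
  rewrite -(@ler_pXn2r _ 2) ?nnegrE ?mulr_ge0 ?nrm_ge0 //.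
  rewrite real_normK ?num_real // !exprMn !nrm_sqr.
  rewrite [leRHS]mulrACA -[n%:R^-1 * _]expr2.
  by apply: ler_wpM2r; rewrite ?sqr_ge0 ?dotp_CS.
rewrite nrm_le ?addr_ge0 ?nrm_ge0 // sqrrD !nrm_sqr sqnormD mulrDl mulrDl.
by rewrite lerD2r lerD2l -mulrA; move: h; lra.
Qed.

Lemma nrmB x y : nrm (x - y) <= nrm x + nrm y.
Proof. by rewrite -(nrmN y) nrmD. Qed.

Lemma nrm_le_coord x a : 0 <= a -> (forall i, `|x ord0 i| <= a) -> nrm x <= a.
Proof.
move=> a0 h; rewrite nrm_le //.
have [n0|n0] := posnP n.
  by rewrite /sqnorm; move: x h; rewrite n0 => x h; rewrite big_ord0 mul0r sqr_ge0.
rewrite ler_pdivrMr ?ltr0n //.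
rewrite mulr_natr -[X in _ *+ X]card_ord -sumr_const; apply: ler_sum => i _.
by rewrite -[_ ^+ 2]real_normK ?num_real // lerXn2r ?nnegrE.
Qed.

End Euclidean.

(** * Counting integer points of balls by base expansions *)

Section LatticeBall.
Variable R : realType.

Lemma intvecD n (x y : 'rV[R]_n) : x \is a mxOver Num.int ->
  y \is a mxOver Num.int -> x + y \is a mxOver Num.int.
Proof. by move=> /mxOverP hx /mxOverP hy; apply/mxOverP => i j; rewrite mxE rpredD. Qed.

Lemma intvecB n (x y : 'rV[R]_n) : x \is a mxOver Num.int ->
  y \is a mxOver Num.int -> x - y \is a mxOver Num.int.
Proof. by move=> /mxOverP hx /mxOverP hy; apply/mxOverP => i j; rewrite !mxE rpredB. Qed.

Definition lbox n (K : nat) : seq 'rV[R]_n :=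
  [seq \row_i ((g i : nat)%:R - K%:R) | g : {ffun 'I_n -> 'I_(K.*2.+1)}].

(** The box loses no point of the ball: an integer coordinate is bounded in absolute value by its
    square, hence by [n * a ^ 2]. *)
Definition lball n (a : nat) : seq 'rV[R]_n :=
  [seq z <- lbox n (n * a ^ 2) | nrm z <= a%:R].

Definition lcube n (b : nat) : seq 'rV[R]_n :=
  [seq \row_i (g i : nat)%:R | g : {ffun 'I_n -> 'I_b}].

Lemma lcube_uniq n b : uniq (lcube n b).
Proof.
rewrite map_inj_uniq ?enum_uniq // => g h /rowP e; apply/ffunP => i.
by apply/val_inj/eqP; rewrite /= -(eqr_nat R); move: (e i); rewrite !mxE => ->.
Qed.

Lemma size_lcube n b : size (lcube n b) = (b ^ n)%N.
Proof. by rewrite size_map -cardT card_ffun !card_ord. Qed.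

Lemma mem_lcube n b z : (0 < b)%N ->
  (z \in lcube n b) = (z \is a mxOver Num.int) && [forall i, 0 <= z ord0 i < b%:R].
Proof.
move=> b0; apply/mapP/idP => [[g _ ->]|/andP[/mxOverP zi /forallP zb]].
  apply/andP; split; first by apply/mxOverP => i j; rewrite mxE natr_int.
  by apply/forallP => i; rewrite mxE ler0n ltr_nat ltn_ord.
have zn i : z ord0 i \is a Num.nat by rewrite natrEint zi; case/andP: (zb i).
have zlt i : (Num.trunc (z ord0 i) < b)%N.
  by rewrite -(ltr_nat R) truncnK //; case/andP: (zb i).
exists [ffun i => Ordinal (zlt i)]; rewrite ?mem_enum //.
by apply/rowP => i; rewrite mxE ffunE /= truncnK.
Qed.

Lemma lbox_uniq n K : uniq (lbox n K).
Proof.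
rewrite map_inj_uniq ?enum_uniq // => g h /rowP e; apply/ffunP => i.
apply/val_inj/eqP; rewrite /= -(eqr_nat R); apply/eqP.
by move: (e i); rewrite !mxE; apply: addIr.
Qed.

Lemma mem_lbox n K z : (z \is a mxOver Num.int) ->
  (forall i, `|z ord0 i| <= K%:R) -> z \in lbox n K.
Proof.
move=> /mxOverP zi zb.
have zn i : z ord0 i + K%:R \is a Num.nat.
  by rewrite natrEint rpredD ?natr_int //= -lerBlDr sub0r; have := zb i;
    rewrite ler_norml => /andP[].
have zlt i : (Num.trunc (z ord0 i + K%:R) < K.*2.+1)%N.
  rewrite ltnS -(ler_nat R) truncnK // -addnn natrD lerD2r.
  by have := zb i; rewrite ler_norml => /andP[].
apply/mapP; exists [ffun i => Ordinal (zlt i)]; rewrite ?mem_enum //.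
by apply/rowP => i; rewrite mxE ffunE /= truncnK // addrK.
Qed.

Lemma lball_uniq n a : uniq (lball n a).
Proof. exact/filter_uniq/lbox_uniq. Qed.

Lemma mem_lball n a z :
  (z \in lball n a) = (z \is a mxOver Num.int) && (nrm z <= a%:R).
Proof.
rewrite mem_filter andbC; apply/andP/andP => [] [h1 h2]; split => //.
  by case/mapP: h1 => g _ ->; apply/mxOverP => i j; rewrite mxE rpredB ?natr_int.
apply: mem_lbox => // i.
have n0 : (0 < n)%N by apply: leq_ltn_trans (ltn_ord i).
apply: (@le_trans _ _ (z ord0 i ^+ 2)).
  have /mxOverP zi := h1.
  have [->|z0] := eqVneq (z ord0 i) 0; first by rewrite normr0 sqr_ge0.
  rewrite -[_ ^+ 2]real_normK ?num_real // expr2 ler_peMr //.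
  exact: norm_intr_ge1.
apply: (@le_trans _ _ (sqnorm z)).
  by rewrite /sqnorm (bigD1 i) //= lerDl sumr_ge0 // => j _; rewrite sqr_ge0.
rewrite sqnormE // natrM ler_wpM2l // natrX lerXn2r ?nnegrE ?nrm_ge0 //.
Qed.

Lemma lball0 n a : 0 \in lball n a.
Proof.
rewrite mem_lball; apply/andP; split; last by rewrite /nrm sqnorm0 mul0r sqrtr0.
by apply/mxOverP => i j; rewrite mxE rpred0.
Qed.

Lemma size_lball_gt0 n a : (0 < size (lball n a))%N.
Proof. by have := lball0 n a; case: (lball n a). Qed.

Lemma nrm_lcube n b z : (0 < b)%N -> z \in lcube n b -> nrm z <= b%:R.
Proof.
move=> b0; rewrite mem_lcube // => /andP[_ /forallP h]; apply: nrm_le_coord => // i.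
by have /andP[h1 h2] := h i; rewrite ger0_norm // ltW.
Qed.

(* Base-[b] digits: the vectors [b k + e] with [k] in a ball and [e] in the cube
   [[0, b)^n] sandwich a ball of [b] times the radius, since [nrm e <= b]. *)
Lemma size_lball_blowup n a b : (0 < b)%N ->
  (size (lball n a) * b ^ n <= size (lball n (a.+1 * b)))%N.
Proof.
move=> b0; rewrite -size_lcube -(size_allpairs (fun k e => b%:R *: k + e)).
apply: uniq_leq_size.
  apply: allpairs_uniq; rewrite ?lball_uniq ?lcube_uniq //.
  move=> [k e] [k' e'] /allpairsP[[k1 e1] /= [h1 h2 [-> ->]]].
  move=> /allpairsP[[k2 e2] /= [h3 h4 [-> ->]]] E.
  suff kk : k1 = k2 by move: E; rewrite kk => /addrI ->.
  (* If the quotients differ at [i], the multiples of [b] are at least [b] apart, while two digits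
     differ by less than [b]. *)
  apply/rowP => i; apply/eqP; rewrite -subr_eq0; apply/negPn/negP => ne.
  move: h1 h3; rewrite !mem_lball => /andP[/mxOverP i1 _] /andP[/mxOverP i2 _].
  have : 1 <= `|k1 ord0 i - k2 ord0 i| by rewrite norm_intr_ge1 // rpredB.
  move: h2 h4; rewrite !mem_lcube // => /andP[_ /forallP/(_ i)/andP[e1a e1b]].
  move=> /andP[_ /forallP/(_ i)/andP[e2a e2b]].
  have /rowP/(_ i) := E; rewrite !mxE => Ei.
  have bp : 0 < b%:R :> R by rewrite ltr0n.
  rewrite -(ler_pM2l bp) mulr1 -{2}(gtr0_norm bp) -normrM mulrBr => h.
  have : `|b%:R * k1 ord0 i - b%:R * k2 ord0 i| < b%:R by rewrite ltr_norml; lra.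
  by rewrite ltNge h.
move=> z /allpairsP[[k e] /= [kb eb ->]].
rewrite mem_lball; move: (kb); rewrite mem_lball => /andP[ki kn].
have en := nrm_lcube b0 eb; move: eb; rewrite mem_lcube // => /andP[ei _].
apply/andP; split; first by rewrite intvecD // mxOverZ // natr_int.
apply: le_trans (nrmD _ _) _; rewrite nrmZ normr_nat mulSnr natrD natrM.
by rewrite lerD // mulrC ler_wpM2r.
Qed.

(** Coordinatewise division by [a] writes [z] as [a k + e] with [e] in the cube; since [nrm e <= a],
    the quotient satisfies [nrm k <= b + 1]. *)
Lemma size_lball_digits n a b : (0 < a)%N ->
  (size (lball n (b * a)) <= size (lball n b.+1) * a ^ n)%N.
Proof.
move=> a0; rewrite -size_lcube -(size_allpairs (fun k e => a%:R *: k + e)).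
apply: uniq_leq_size; rewrite ?lball_uniq // => z.
have ap : 0 < a%:R :> R by rewrite ltr0n.
rewrite mem_lball => /andP[/mxOverP zi zn].
pose k : 'rV[R]_n := \row_i (Num.floor (z ord0 i / a%:R))%:~R.
have ki : k \is a mxOver Num.int by apply/mxOverP => i j; rewrite mxE intr_int.
have eb : z - a%:R *: k \in lcube n a.
  rewrite mem_lcube //; apply/andP; split.
    by rewrite intvecB //; [exact/mxOverP | rewrite mxOverZ // natr_int].
  apply/forallP => i; rewrite !mxE.
  have /andP[h1 h2] := floor_itv (z ord0 i / a%:R).
  rewrite subr_ge0 mulrC -ler_pdivlMr // h1 /=.
  move: h2; rewrite ltr_pdivrMr // intrD; lra.
apply/allpairsP; exists (k, z - a%:R *: k) => /=; split => //; last by rewrite addrC subrK.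
rewrite mem_lball ki /= -(ler_pM2l ap) -{1}(gtr0_norm ap) -nrmZ.
have -> : a%:R *: k = z - (z - a%:R *: k) by rewrite opprB addrC subrK.
apply: le_trans (nrmB _ _) _.
have -> : a%:R * b.+1%:R = (b * a)%:R + a%:R :> R by rewrite -natrM -natrD; congr _%:R; lia.
by rewrite lerD // nrm_lcube.
Qed.

(** Both sides are compared with the ball of radius [a * b]. This replaces the scaling of volumes,
    at the price of shifting each radius by one. *)
Lemma size_lball_ratio n a b : (0 < a)%N -> (0 < b)%N ->
  (b ^ n * size (lball n a.-1) <= a ^ n * size (lball n b.+1))%N.
Proof.
move=> a0 b0; rewrite mulnC (leq_trans (size_lball_blowup _ _ b0)) //.
by rewrite prednK // mulnC [leqRHS]mulnC size_lball_digits.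
Qed.

End LatticeBall.

(** * Crude size and second moments of integer balls *)

Section LatticeSums.
Variable R : realType.

(** With truncated subtraction the exponent is the distance from [j] to [K]. Passing to [K.+1] adds
    one term [2^-1 ^+ K.+1] at each end. *)
Lemma sum_half_dist (K : nat) :
  \sum_(j < K.*2.+1) 2^-1 ^+ ((j - K) + (K - j)) = 3 - 2 * 2^-1 ^+ K :> R.
Proof.
elim: K => [|K IH]; first by rewrite big_ord_recl big_ord0 /= expr0; lra.
rewrite doubleS big_ord_recr big_ord_recl /=.
have -> : \sum_(i < K.*2.+1) 2^-1 ^+ (bump 0 i - K.+1 + (K.+1 - bump 0 i)) =
    3 - 2 * 2^-1 ^+ K :> R.
  by rewrite -IH; apply: eq_bigr => i _; rewrite /bump /= add1n !subSS.
have -> : (0 - K.+1 + (K.+1 - 0) = K.+1)%N by lia.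
have -> : (K.*2.+2 - K.+1 + (K.+1 - K.*2.+2) = K.+1)%N by lia.
by rewrite exprS; lra.
Qed.

(* Each [z] in the ball satisfies [\sum_i |z_i| <= n a^2], so it has weight at least
   [2^-(n a^2)] in the product of the summable weights [2^-|z_i|]. *)
Lemma size_lball_le n a : (size (lball R n a) <= (3 * 2 ^ (a ^ 2)) ^ n)%N.
Proof.
rewrite -(ler_nat R) natrX natrM.
set K := (n * a ^ 2)%N.
have e0 : (0 : R) < 2^-1 by rewrite invr_gt0.
have w0 (g : {ffun 'I_n -> 'I_(K.*2.+1)}) :
    0 <= \prod_i 2^-1 ^+ ((g i - K) + (K - g i)) :> R.
  by apply: prodr_ge0 => i _; rewrite exprn_ge0 ?ltW.
have -> : (3%:R * (2 ^ (a ^ 2))%:R) ^+ n = 2 ^+ K * 3 ^+ n :> R.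
  by rewrite exprMn natrX -exprM mulrC /K mulnC.
have h3 : \sum_(g : {ffun 'I_n -> 'I_(K.*2.+1)})
    \prod_i 2^-1 ^+ ((g i - K) + (K - g i)) <= 3 ^+ n :> R.
  rewrite -(bigA_distr_bigA (fun (i : 'I_n) (j : 'I_(K.*2.+1)) =>
    2^-1 ^+ ((j - K) + (K - j)) : R)).
  have s0 : 0 <= \sum_(j < K.*2.+1) 2^-1 ^+ ((j - K) + (K - j)) :> R.
    by apply: sumr_ge0 => i _; rewrite exprn_ge0 ?ltW.
  rewrite big_const_ord iter_mulr_1 lerXn2r ?nnegrE //.
  by rewrite sum_half_dist lerBlDr lerDl mulr_ge0 ?exprn_ge0 ?ltW.
apply: le_trans (ler_wpM2l _ h3); last by rewrite exprn_ge0.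
rewrite mulr_sumr size_filter count_map -sum1_count big_enum_cond natr_sum /=.
rewrite [leLHS]big_mkcond; apply: ler_sum => g _.
case: ifP => [|_]; last by rewrite mulr_ge0 ?exprn_ge0.
rewrite nrm_le //; set z := \row_i _ => zn.
rewrite prodrXr exprVn -[leLHS](@mulfV _ (2 ^+ (\sum_i (g i - K + (K - g i)))));
  last by rewrite expf_neq0.
rewrite ler_wpM2r ?invr_ge0 ?exprn_ge0 // ler_weXn2l ?ler1n //.
rewrite -(ler_nat R) natr_sum.
apply: (@le_trans _ _ (sqnorm z)).
  apply: ler_sum => i _; rewrite mxE.
  have [h|h] := leqP K (g i).
    have -> : (g i - K + (K - g i) = g i - K)%N by lia.
    rewrite -natrB // -natrX ler_nat -{1}[(g i - K)%N]expn1.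
    by case: (g i - K)%N => // m; rewrite leq_pexp2l.
  have -> : (g i - K + (K - g i) = K - g i)%N by lia.
  rewrite -sqrrN opprB -natrB ?(ltnW h) // -natrX ler_nat.
  by rewrite -{1}[(K - g i)%N]expn1; case: (K - g i)%N => // m; rewrite leq_pexp2l.
have [n0|n0] := posnP n.
  suff -> : sqnorm z = 0 by [].
  by apply: big1 => i _; have : (i < 0)%N by rewrite -n0.
by move: zn; rewrite ler_pdivrMr ?ltr0n // mulrC /K natrM natrX.
Qed.

Lemma sum_lball_invol n b (phi : 'rV[R]_n -> 'rV[R]_n) (F : 'rV[R]_n -> R) :
  involutive phi -> {in lball R n b, forall z, phi z \in lball R n b} ->
  \sum_(z <- lball R n b) F (phi z) = \sum_(z <- lball R n b) F z.
Proof.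
move=> phiK phib; rewrite -[LHS](big_map phi xpredT F); apply: perm_big.
apply: uniq_perm; rewrite ?map_inj_uniq ?lball_uniq //; first exact: can_inj phiK.
move=> z; apply/mapP/idP => [[y yb ->]|zb]; first exact: phib.
by exists (phi z); rewrite ?phiK ?phib.
Qed.

(** Reversing the sign of coordinate [i] preserves the ball and negates the summand. *)
Lemma sum_lball_cross n b (i j : 'I_n) : i != j ->
  \sum_(z <- lball R n b) z ord0 i * z ord0 j = 0.
Proof.
move=> ij; pose phi (z : 'rV[R]_n) : 'rV[R]_n :=
  \row_k (if k == i then - z ord0 k else z ord0 k).
have phiK : involutive phi.
  by move=> z; apply/rowP => k; rewrite !mxE; case: eqP => // ->; rewrite opprK.
have phib : {in lball R n b, forall z, phi z \in lball R n b}.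
  move=> z; rewrite !mem_lball => /andP[/mxOverP zi zn]; apply/andP; split.
    by apply/mxOverP => k l; rewrite mxE; case: ifP => _; rewrite ?rpredN.
  rewrite /nrm (_ : sqnorm _ = sqnorm z) //; apply: eq_bigr => k _.
  by rewrite mxE; case: ifP; rewrite ?sqrrN.
have := sum_lball_invol (fun z => z ord0 i * z ord0 j) phiK phib.
rewrite (eq_bigr (fun z : 'rV[R]_n => - (z ord0 i * z ord0 j))); last first.
  by move=> z _; rewrite !mxE eqxx eq_sym (negbTE ij) mulNr.
by rewrite sumrN => h; lra.
Qed.

Lemma sum_lball_diag n b (i j : 'I_n) :
  \sum_(z <- lball R n b) z ord0 i ^+ 2 = \sum_(z <- lball R n b) z ord0 j ^+ 2.
Proof.
have phiK : involutive (@xcol R 1 n i j).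
  by move=> z; apply/rowP => k; rewrite !mxE tpermK.
have phib : {in lball R n b, forall z, xcol i j z \in lball R n b}.
  move=> z; rewrite !mem_lball => /andP[/mxOverP zi zn]; apply/andP; split.
    by apply/mxOverP => k l; rewrite mxE.
  rewrite /nrm (_ : sqnorm _ = sqnorm z) // /sqnorm.
  rewrite [RHS](reindex_inj (@perm_inj _ (tperm i j))).
  by apply: eq_bigr => k _; rewrite mxE.
rewrite -(sum_lball_invol (fun z => z ord0 j ^+ 2) phiK phib).
by apply: eq_bigr => z _; rewrite mxE tpermR.
Qed.

(** The ball is isotropic: mixed second moments vanish and the [n] diagonal ones are equal, so each
    is one [n]-th of the sum of [sqnorm z]. *)
Lemma sum_lball_dotp n b (x : 'rV[R]_n) :
  n%:R * \sum_(z <- lball R n b) dotp x z ^+ 2 =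
  sqnorm x * \sum_(z <- lball R n b) sqnorm z.
Proof.
have -> : \sum_(z <- lball R n b) dotp x z ^+ 2 =
    \sum_(i < n) x ord0 i ^+ 2 * \sum_(z <- lball R n b) z ord0 i ^+ 2.
  transitivity (\sum_(z <- lball R n b) \sum_(i < n) \sum_(j < n)
      (x ord0 i * x ord0 j) * (z ord0 i * z ord0 j)).
    apply: eq_bigr => z _; rewrite expr2 {1}/dotp mulr_suml; apply: eq_bigr => i _.
    by rewrite /dotp mulr_sumr; apply: eq_bigr => j _; rewrite mulrACA.
  rewrite exchange_big; apply: eq_bigr => i _.
  rewrite exchange_big (bigD1 i) //= [X in _ + X]big1 ?addr0 => [|j ji].
    by rewrite mulr_sumr; apply: eq_bigr => z _; rewrite -!expr2.
  by rewrite -mulr_sumr sum_lball_cross ?mulr0 // eq_sym.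
rewrite mulr_sumr /sqnorm mulr_suml; apply: eq_bigr => i _.
rewrite mulrCA exchange_big /=; congr (_ * _).
transitivity (\sum_(j < n) \sum_(z <- lball R n b) z ord0 i ^+ 2).
  by rewrite sumr_const card_ord mulr_natl.
by apply: eq_bigr => j _; apply: sum_lball_diag.
Qed.

(* Chebyshev's inequality: the coordinates of a uniform point of the ball are uncorrelated
   with equal variances. *)
Lemma lball_almost_orthogonal n b (x : 'rV[R]_n) (p : R) : (0 < n)%N ->
  nrm x ^+ 2 <= p -> 2 * p * b%:R ^+ 2 <= n%:R ->
  (size (lball R n b) <= 2 * size [seq z <- lball R n b | (`|dotp x z| <= n%:R)%R])%N.
Proof.
move=> n0 xp pb; have np : 0 < n%:R :> R by rewrite ltr0n.
set B := lball R n b; rewrite size_filter.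
have := count_predC (fun z => `|dotp x z| <= n%:R) B.
set u := count _ B; set v := count _ B => uv.
suff : v%:R * 2 <= (size B)%:R :> R by rewrite -natrM ler_nat; lia.
have h1 : n%:R ^+ 2 * v%:R <= \sum_(z <- B) dotp x z ^+ 2.
  rewrite /v -sum1_count natr_sum mulr_sumr big_mkcond /=; apply: ler_sum => z _.
  rewrite mulr1; case: ifP => [|_]; last by rewrite sqr_ge0.
  by rewrite -ltNge => h; rewrite -[leRHS]real_normK ?num_real // lerXn2r ?nnegrE // ltW.
have h2 : \sum_(z <- B) sqnorm z <= (size B)%:R * (n%:R * b%:R ^+ 2).
  have -> : (size B)%:R * (n%:R * b%:R ^+ 2) = \sum_(z <- B) (n%:R * b%:R ^+ 2) :> R.
    by rewrite big_const_seq iter_addr_0 count_predT mulr_natl.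
  rewrite big_seq [leRHS]big_seq.
  apply: ler_sum => z; rewrite mem_lball => /andP[_ zb].
  by rewrite sqnormE // ler_wpM2l // lerXn2r ?nnegrE ?nrm_ge0.
have h3 := sum_lball_dotp b x; rewrite -/B (sqnormE x n0) in h3.
have h4 : \sum_(z <- B) dotp x z ^+ 2 <= p * ((size B)%:R * (n%:R * b%:R ^+ 2)).
  rewrite -(ler_pM2l np) h3 -mulrA ler_wpM2l // ler_pM ?sqr_ge0 ?sumr_ge0 //.
  by move=> z _; rewrite sqnorm_ge0.
have h5 : n%:R ^+ 2 * (v%:R * 2) <= n%:R ^+ 2 * (size B)%:R :> R.
  apply: (@le_trans _ _ (2 * (p * ((size B)%:R * (n%:R * b%:R ^+ 2))))).
    by rewrite mulrA mulrC ler_pM2l // (le_trans h1).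
  have -> : 2 * (p * ((size B)%:R * (n%:R * b%:R ^+ 2))) =
    (2 * p * b%:R ^+ 2) * (n%:R * (size B)%:R) by ring.
  by rewrite [n%:R ^+ 2]expr2 -[leRHS]mulrA ler_wpM2r // mulr_ge0.
by move: h5; rewrite ler_pM2l // exprn_gt0.
Qed.

End LatticeSums.

(** * Average radius, and the upper bound by double counting *)

Section AverageRadius.
Variables (R : realType) (n : nat).
Implicit Types (x y z : 'rV[R]_n) (s C : seq 'rV[R]_n).

Lemma sum_dotp s (f : 'rV[R]_n -> 'rV[R]_n) y :
  \sum_(x <- s) dotp (f x) y = dotp (\sum_(x <- s) f x) y.
Proof.
by rewrite /dotp exchange_big; apply: eq_bigr => i _; rewrite summxE mulr_suml.
Qed.

(** Parallel axis identity: the cross terms cancel because the deviations from the centroid sum to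
    zero. *)
Lemma sum_sqnorm_centroid s y : (0 < size s)%N ->
  \sum_(x <- s) sqnorm (x - y) =
  \sum_(x <- s) sqnorm (x - centroid s) + (size s)%:R * sqnorm (centroid s - y).
Proof.
move=> s0; have sc : (size s)%:R *: centroid s = \sum_(x <- s) x.
  by rewrite /centroid scalerA divff ?scale1r // pnatr_eq0 -lt0n.
have sumc : \sum_(x <- s) (x - centroid s) = 0.
  by rewrite sumrB -sc big_const_seq iter_addr_0 count_predT scaler_nat subrr.
transitivity (\sum_(x <- s) (sqnorm (x - centroid s) +
    2 * dotp (x - centroid s) (centroid s - y) + sqnorm (centroid s - y))).
  by apply: eq_bigr => x _; rewrite -sqnormD addrA subrK.
rewrite !big_split /= -mulr_sumr sum_dotp sumc; congr (_ + _); last first.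
  by rewrite big_const_seq iter_addr_0 count_predT mulr_natl.
by rewrite /dotp [\sum_(i < n) _]big1 ?mulr0 ?addr0 // => i _; rewrite mxE mul0r.
Qed.

(** The centroid minimizes the mean squared distance, so any centre [y] gives an upper bound. *)
Lemma avg_sq_rad_le s y (r : R) : (0 < size s)%N ->
  (forall x, x \in s -> sqnorm (x - y) <= r) -> avg_sq_rad s <= r.
Proof.
move=> s0 h; have sp : 0 < (size s)%:R :> R by rewrite ltr0n.
rewrite /avg_sq_rad mulrC ler_pdivrMr //.
apply: (@le_trans _ _ (\sum_(x <- s) sqnorm (x - y))).
  by rewrite (sum_sqnorm_centroid y s0) lerDl mulr_ge0 ?sqnorm_ge0.
have -> : r * (size s)%:R = \sum_(x <- s) r.
  by rewrite big_const_seq iter_addr_0 count_predT mulr_natr.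
by rewrite big_seq [leRHS]big_seq; apply: ler_sum.
Qed.

Lemma avg_sq_radZ (c : R) s :
  avg_sq_rad [seq c *: x | x <- s] = c ^+ 2 * avg_sq_rad s.
Proof.
rewrite /avg_sq_rad /centroid size_map !big_map -scaler_sumr.
rewrite [RHS]mulrCA; congr (_ * _); rewrite mulr_sumr; apply: eq_bigr => x _.
by rewrite scalerA [_ * c]mulrC -scalerA -scalerBr sqnormZ.
Qed.

(** The grid stays [Z^n] throughout; instead of refining it, codes are dilated until their radii
    fit. *)
Lemma avg_rad_LD_codeZ (P N c : R) L C : c != 0 -> avg_rad_LD_code P N L C ->
  avg_rad_LD_code (c ^+ 2 * P) (c ^+ 2 * N) L [seq c *: x | x <- C].
Proof.
move=> c0 [uC [bC lC]]; have c2 : 0 < c ^+ 2 by rewrite lt_neqAle sqr_ge0 eq_sym sqrf_eq0 c0.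
split; first by rewrite map_inj_uniq //; apply: scalerI.
split=> [y /mapP[x xC ->]|s us sL sC].
  by rewrite sqnormZ mulrCA ler_pM2l // bC.
have -> : s = [seq c *: x | x <- [seq c^-1 *: x | x <- s]].
  by rewrite -map_comp map_id_in // => x _; rewrite /= scalerA divff ?scale1r.
rewrite avg_sq_radZ mulrCA ltr_pM2l //; apply: lC; rewrite ?size_map //.
  by rewrite map_inj_uniq //; apply/scalerI/invr_neq0.
move=> y /mapP[x /sC/mapP[z zC ->] ->].
by rewrite scalerA mulVf // scale1r.
Qed.

Lemma size_code_near (P N : R) L C y : (0 < L)%N -> avg_rad_LD_code P N L C ->
  (count (fun x => (sqnorm (x - y) <= n%:R * N)%R) C < L)%N.
Proof.
move=> L0 [uC [_ lC]]; rewrite -size_filter ltnNge; apply/negP => h.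
set D := [seq x <- C | _] in h.
have st : size (take L D) = L by rewrite size_take_min; apply/minn_idPl.
have sub : {subset take L D <= D} by apply: mem_take.
have := lC (take L D); rewrite take_uniq ?filter_uniq // st => /(_ erefl erefl) hh.
have : avg_sq_rad (take L D) <= n%:R * N.
  apply: (avg_sq_rad_le (y := y)); rewrite ?st // => x /sub.
  by rewrite mem_filter => /andP[].
rewrite leNgt hh // => x /sub; by rewrite mem_filter => /andP[].
Qed.

(** For [P <= N] the whole code lies within the decoding radius of the origin. *)
Lemma size_code_lt (P N : R) L C : (0 < L)%N -> P <= N ->
  avg_rad_LD_code P N L C -> (size C < L)%N.
Proof.
move=> L0 PN CC; apply: leq_ltn_trans (size_code_near 0 L0 CC).
rewrite -[leqLHS]count_predT; apply/eq_leq/eq_in_count => x xC /=.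
by apply/esym; rewrite subr0 (le_trans (CC.2.1 x xC)) // ler_wpM2l.
Qed.

Definition floorv x : 'rV[R]_n := \row_i (Num.floor (x ord0 i))%:~R.

Lemma floorv_int x : floorv x \is a mxOver Num.int.
Proof. by apply/mxOverP => i j; rewrite mxE intr_int. Qed.

Lemma nrm_sub_floorv x : nrm (x - floorv x) <= 1.
Proof.
apply: nrm_le_coord => // i; rewrite !mxE.
have /andP[h1 h2] := floor_itv (x ord0 i).
by rewrite ger0_norm ?subr_ge0 // lerBlDl ltW //; move: h2; rewrite intrD addrC.
Qed.

Lemma nrmZDE (c : R) x z :
  nrm (c *: x + z) ^+ 2 = c ^+ 2 * nrm x ^+ 2 + 2 * c * (dotp x z / n%:R) + nrm z ^+ 2.
Proof. by rewrite !nrm_sqr sqnormD sqnormZ dotpZl; ring. Qed.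

(* If [nrm x = a / sqrt alpha], then for [z] orthogonal to [x] with [nrm z = a sqrt beta] the
   point [alpha x + z] is at distance [a] from [0] and [r] from [x]. Most lattice points [z] of
   a ball are nearly orthogonal to [x]; a slightly smaller ball absorbs the error of this and
   of rounding [alpha x] to a lattice point. *)
Lemma lball_near (a b : nat) (alpha beta r : R) x : (0 < n)%N ->
  0 < alpha -> 0 <= beta -> alpha + beta = 1 -> alpha * r ^+ 2 = beta * a%:R ^+ 2 ->
  1 <= r -> (0 < a)%N ->
  b%:R ^+ 2 + 2 * r + 1 <= beta * a%:R ^+ 2 ->
  b%:R ^+ 2 + 2 * a%:R + 1 <= beta * a%:R ^+ 2 ->
  2 * (a%:R ^+ 2 / alpha) * b%:R ^+ 2 <= n%:R ->
  alpha * nrm x ^+ 2 <= a%:R ^+ 2 ->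
  (size (lball R n b) <= 2 * count (fun k => (nrm (x - k) <= r)%R) (lball R n a))%N.
Proof.
move=> n0 al0 be0 ab rE r1 a0 hr ha hn xa.
have np : 0 < n%:R :> R by rewrite ltr0n.
have xp : nrm x ^+ 2 <= a%:R ^+ 2 / alpha by rewrite ler_pdivlMr // mulrC.
apply: leq_trans (lball_almost_orthogonal n0 xp hn) _.
rewrite leq_mul2l /= -[X in (_ <= X)%N]size_filter.
(* The wanted grid points are the translates [c0 + z] with [z] in [G], where [c0] is [alpha *: x]
   rounded to the lattice. *)
set G := [seq z <- _ | _]; pose c0 := floorv (alpha *: x).
have fl := nrm_sub_floorv (alpha *: x); rewrite -/c0 in fl.
rewrite -(size_map (fun z => c0 + z)); apply: uniq_leq_size.
  have uG : uniq G by apply/filter_uniq/lball_uniq.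
  by rewrite map_inj_uniq // => u v /addrI.
move=> k /mapP[z]; rewrite mem_filter mem_lball => /andP[dz /andP[zi zb]] ->.
have zb2 : nrm z ^+ 2 <= b%:R ^+ 2 by rewrite lerXn2r ?nnegrE ?nrm_ge0.
have /andP[d1 d2] : -1 <= dotp x z / n%:R <= 1.
  by rewrite ler_pdivlMr // ler_pdivrMr // mulN1r mul1r -ler_norml.
set d := dotp x z / n%:R in d1 d2.
have X0 : 0 <= nrm x ^+ 2 by rewrite sqr_ge0.
have a1 : 1 <= a%:R :> R by rewrite ler1n.
have xa2 : alpha ^+ 2 * nrm x ^+ 2 <= alpha * a%:R ^+ 2.
  by rewrite expr2 -mulrA ler_pM2l.
rewrite mem_filter mem_lball intvecD ?floorv_int //=; apply/andP; split.
  have -> : x - (c0 + z) = (alpha *: x - c0) - ((- beta) *: x + z).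
    have -> : alpha = 1 - beta by lra.
    by rewrite scalerBl scale1r scaleNr; apply/rowP => i; rewrite !mxE; ring.
  apply: le_trans (nrmB _ _) _; suff : nrm (- beta *: x + z) <= r - 1 by lra.
  rewrite -(@ler_pXn2r _ 2) ?nnegrE ?nrm_ge0 ?subr_ge0 // nrmZDE -/d.
  have : beta ^+ 2 * nrm x ^+ 2 <= beta * r ^+ 2.
    rewrite expr2 -mulrA ler_wpM2l // -(ler_pM2l al0) rE mulrCA.
    by rewrite ler_wpM2l.
  have : - beta * d <= beta by nra.
  (* The relation between [r] and [a] trades [beta r^2] for [r^2] with a gain of [beta a^2], which
     pays for [b^2], for the rounding loss [2 r] and for the cross term. *)
  have -> : beta * r ^+ 2 = r ^+ 2 - beta * a%:R ^+ 2.
    by rewrite -rE (_ : beta = 1 - alpha); [ring | lra].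
  have : beta <= 1 by lra.
  rewrite sqrrB expr1n mulr1; lra.
have -> : c0 + z = (alpha *: x + z) - (alpha *: x - c0).
  by apply/rowP => i; rewrite !mxE; ring.
apply: le_trans (nrmB _ _) _; suff : nrm (alpha *: x + z) <= a%:R - 1 by lra.
rewrite -(@ler_pXn2r _ 2) ?nnegrE ?nrm_ge0 ?subr_ge0 // nrmZDE -/d.
have : alpha * d <= alpha by nra.
have : alpha * a%:R ^+ 2 = a%:R ^+ 2 - beta * a%:R ^+ 2.
  by rewrite (_ : beta = 1 - alpha); [ring | lra].
have : alpha <= 1 by lra.
rewrite sqrrB expr1n mulr1; lra.
Qed.

(** Double counting of the pairs of a codeword and a grid point at distance at most [r]: a codeword
    has at least half of [size (lball R n b)] such neighbours, a grid point at most [L]. *)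
Lemma size_code_le (a b L : nat) (P N alpha beta r : R) C : (0 < n)%N -> (0 < L)%N ->
  0 < alpha -> 0 <= beta -> alpha + beta = 1 -> alpha * r ^+ 2 = beta * a%:R ^+ 2 ->
  1 <= r -> (0 < a)%N ->
  b%:R ^+ 2 + 2 * r + 1 <= beta * a%:R ^+ 2 ->
  b%:R ^+ 2 + 2 * a%:R + 1 <= beta * a%:R ^+ 2 ->
  2 * (a%:R ^+ 2 / alpha) * b%:R ^+ 2 <= n%:R ->
  alpha * P = a%:R ^+ 2 -> N = r ^+ 2 -> avg_rad_LD_code P N L C ->
  (size C * size (lball R n b) <= 2 * L * size (lball R n a))%N.
Proof.
move=> n0 L0 al0 be0 ab rE r1 a0 hr ha hn PE NE CC.
have np : 0 < n%:R :> R by rewrite ltr0n.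
have h1 : (size C * size (lball R n b) <=
    \sum_(x <- C) 2 * \sum_(k <- lball R n a) (nrm (x - k) <= r)%R)%N.
  have -> : (size C * size (lball R n b) = \sum_(x <- C) size (lball R n b))%N.
    by rewrite big_const_seq iter_addn_0 count_predT mulnC.
  rewrite big_seq [leqRHS]big_seq; apply: leq_sum => x xC.
  rewrite -big_mkcond sum1_count.
  apply: (lball_near _ al0 be0 ab rE r1 a0 hr ha hn) => //.
  have := CC.2.1 x xC; rewrite sqnormE // ler_pM2l // -PE => h.
  by rewrite ler_pM2l.
apply: leq_trans h1 _; rewrite -big_distrr /= exchange_big -mulnA leq_mul2l /=.
have -> : (L * size (lball R n a) = \sum_(k <- lball R n a) L)%N.
  by rewrite big_const_seq iter_addn_0 count_predT.
apply: leq_sum => k _; rewrite -big_mkcond sum1_count.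
apply: ltnW; apply: leq_ltn_trans (size_code_near k L0 CC).
apply/eq_leq/eq_count => x; rewrite /= nrm_le ?(le_trans ler01) // NE.
by rewrite ler_pdivrMr // mulrC.
Qed.

End AverageRadius.

(** * Independence and the union bound, in counting form *)

Section UnionBound.
Local Open Scope nat_scope.

(** As [tau] is injective, the constraints concern distinct coordinates of a uniform [c], so their
    joint probability is at most the product of the [#|B i| / #|T|]; denominators are cleared. *)
Lemma card_constrained_ffun (T : finType) (M L : nat) (tau : 'I_L -> 'I_M)
    (B : 'I_L -> {set T}) : injective tau ->
  #|[set c : {ffun 'I_M -> T} | [forall i, c (tau i) \in B i]]| * #|T| ^ L <=
  #|T| ^ M * \prod_i #|B i|.
Proof.
move=> tau_inj; pose F (j : 'I_M) : {set T} :=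
  [set t | [forall i, (tau i == j) ==> (t \in B i)]].
have h1 : #|[set c : {ffun 'I_M -> T} | [forall i, c (tau i) \in B i]]| <=
    \prod_j #|F j|.
  have -> : \prod_j #|F j| = #|family (fun j => mem (F j))|.
    by rewrite card_family foldrE big_map big_enum.
  apply/subset_leq_card/fintype.subsetP => c; rewrite inE => /forallP h.
  apply/familyP => j; rewrite inE; apply/forallP => i; apply/implyP => /eqP <-.
  exact: h.
apply: leq_trans (leq_mul h1 (leqnn _)) _.
(* An index [tau i] contributes at most [#|B i|], an index outside the image at most [#|T|]. *)
rewrite (bigID (mem (tau @: [set: 'I_L]))) /= big_imset /=; last by move=> x y _ _ /tau_inj.
rewrite -mulnA mulnC leq_mul //; last first.
  rewrite (eq_bigl xpredT) => [|i]; last by rewrite inE.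
  apply: leq_prod => i _; apply/subset_leq_card/fintype.subsetP => t.
  by rewrite inE => /forallP/(_ i); rewrite eqxx.
apply: (@leq_trans (#|T| ^ #|~: (tau @: [set: 'I_L])| * #|T| ^ L)).
  rewrite leq_mul2r; apply/orP; right.
  rewrite -prod_nat_const [leqRHS](eq_bigl (fun j => j \notin tau @: [set: 'I_L])).
    by apply: leq_prod => j _; apply: max_card.
  by move=> j; rewrite inE.
rewrite -expnD; have := cardsC (tau @: [set: 'I_L]).
by rewrite card_imset // cardsT !card_ord addnC => ->.
Qed.

(** [E] indexes the bad events. There are at most [M ^ L] choices of [tau], so the hypothesis puts
    the union bound over all pairs [(tau, e)] below one. *)
Lemma exists_avoiding_ffun (T E : finType) (M L : nat) (A : E -> 'I_L -> {set T}) :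
  0 < L -> M ^ L * \sum_e \prod_i #|A e i| < #|T| ^ L ->
  exists c : {ffun 'I_M -> T}, forall tau : {ffun 'I_L -> 'I_M}, injective tau ->
    forall e, exists i, c (tau i) \notin A e i.
Proof.
move=> L0 hlt; apply: contrapT => hno.
pose bad tau e := [set c : {ffun 'I_M -> T} | [forall i, c (tau i) \in A e i]].
have allbad (c : {ffun 'I_M -> T}) :
    1 <= \sum_(tau : {ffun 'I_L -> 'I_M} | injectiveb tau) \sum_e (c \in bad tau e).
  rewrite lt0n; apply/negP => /eqP h; apply: hno; exists c => tau /injectiveP ti e.
  move/eqP: h; rewrite sum_nat_eq0 => /forallP/(_ tau)/implyP/(_ ti).
  rewrite sum_nat_eq0 => /forallP/(_ e)/=; rewrite inE eqb0 negb_forall => /existsP[i hi].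
  by exists i.
have T0 : 0 < #|T| by case: #|T| hlt => //; rewrite exp0n.
have h1 : #|T| ^ M <= \sum_(tau : {ffun 'I_L -> 'I_M} | injectiveb tau) \sum_e #|bad tau e|.
  have -> : #|T| ^ M = \sum_(c : {ffun 'I_M -> T}) 1.
    by rewrite sum1_card card_ffun card_ord.
  apply: (@leq_trans (\sum_(c : {ffun 'I_M -> T})
      \sum_(tau : {ffun 'I_L -> 'I_M} | injectiveb tau) \sum_e (c \in bad tau e))).
    by apply: leq_sum => c _.
  rewrite exchange_big; apply: leq_sum => tau _; rewrite exchange_big.
  by apply: leq_sum => e _; rewrite -big_mkcond sum1_card.
have h2 : #|T| ^ M * #|T| ^ L <= #|T| ^ M * (M ^ L * \sum_e \prod_i #|A e i|).
  apply: leq_trans (leq_mul h1 (leqnn _)) _.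
  rewrite big_distrl /= mulnCA.
  have -> : M ^ L * (#|T| ^ M * \sum_e \prod_i #|A e i|) =
      \sum_(tau : {ffun 'I_L -> 'I_M}) (#|T| ^ M * \sum_e \prod_i #|A e i|).
    by rewrite sum_nat_const card_ffun !card_ord.
  rewrite big_mkcond /=; apply: leq_sum => tau _; case: ifP => // /injectiveP ti.
  rewrite big_distrl big_distrr; apply: leq_sum => e _.
  exact: card_constrained_ffun.
by move: h2; rewrite leq_mul2l expn_eq0 -[#|T| == 0]negbK -lt0n T0 /= leqNgt hlt.
Qed.

End UnionBound.

(** * Random codes on the integer grid *)

Section RandomCode.
Variables (R : realType) (n : nat).
Hypothesis n0 : (0 < n)%N.

Lemma nrm_sum (I : Type) (r : seq I) (f : I -> 'rV[R]_n) :
  nrm (\sum_(i <- r) f i) <= \sum_(i <- r) nrm (f i).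
Proof.
apply: (big_ind2 (fun x (a : R) => nrm x <= a)) => //.
  by rewrite /nrm sqnorm0 mul0r sqrtr0.
by move=> x a y b hx hy; apply: le_trans (nrmD _ _) (lerD hx hy).
Qed.

Lemma nrm_centroid_le (s : seq 'rV[R]_n) (a : R) : (0 < size s)%N ->
  {in s, forall x, nrm x <= a} -> nrm (centroid s) <= a.
Proof.
move=> s0 h; have sp : 0 < (size s)%:R :> R by rewrite ltr0n.
rewrite /centroid nrmZ ger0_norm ?invr_ge0 ?ler0n // mulrC ler_pdivrMr //.
apply: le_trans (nrm_sum _ _) _.
have -> : a * (size s)%:R = \sum_(x <- s) a.
  by rewrite big_const_seq iter_addr_0 count_predT mulr_natr.
by rewrite big_seq [leRHS]big_seq; apply: ler_sum.
Qed.

Lemma sum_le_of_sum_sqr (L : nat) (u : 'I_L -> R) (q : R) : 0 < q ->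
  \sum_i u i ^+ 2 <= L%:R * q ^+ 2 -> \sum_i u i <= L%:R * q.
Proof.
move=> q0 h; rewrite -(@ler_pM2l _ (2 * q)) ?mulr_gt0 //.
apply: (@le_trans _ _ (\sum_i (u i ^+ 2 + q ^+ 2))).
  rewrite mulr_sumr; apply: ler_sum => i _; rewrite -subr_ge0.
  by have := sqr_ge0 (u i - q); rewrite sqrrB; lra.
by rewrite big_split /= sumr_const card_ord -mulr_natl; lra.
Qed.

(* Quantization of the list configurations violating the radius condition: the centroid
   is rounded to a lattice point [y] and the distances to [y] are rounded up. *)
Lemma bad_list_quantize (a L : nat) (rho : R) (p : 'I_L -> 'rV[R]_n) :
  (0 < L)%N -> 0 <= rho -> (forall i, p i \in lball R n a) ->
  avg_sq_rad [seq p i | i <- enum 'I_L] <= n%:R * rho ^+ 2 ->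
  exists2 y, y \in lball R n a.+1 &
  exists2 d : {ffun 'I_L -> 'I_(a.*2.+3)},
    (forall i, p i - y \in lball R n (d i)) &
    \prod_i (d i).+1%:R <= (rho + 3) ^+ L.
Proof.
move=> L0 rho0 pb; set s := map _ _.
have ss : size s = L by rewrite size_map size_enum_ord.
have np : 0 < n%:R :> R by rewrite ltr0n.
have Lp : 0 < L%:R :> R by rewrite ltr0n.
rewrite /avg_sq_rad ss mulrC ler_pdivrMr // => hs.
have cn : nrm (centroid s) <= a%:R.
  apply: nrm_centroid_le; rewrite ?ss // => x /mapP[i _ ->].
  by have := pb i; rewrite mem_lball => /andP[].
pose y := floorv (centroid s).
have fl : nrm (centroid s - y) <= 1 := nrm_sub_floorv _.
have yn : nrm y <= a.+1%:R.
  have -> : y = centroid s - (centroid s - y) by rewrite opprB addrC subrK.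
  by apply: le_trans (nrmB _ _) _; rewrite -natr1 lerD.
have yb : y \in lball R n a.+1 by rewrite mem_lball floorv_int.
exists y => //.
have un i : nrm (p i - y) < a.*2.+2%:R.
  apply: le_lt_trans (nrmB _ _) _.
  have := pb i; rewrite mem_lball => /andP[_ h].
  apply: (@le_lt_trans _ _ (a%:R + a.+1%:R)); first exact: lerD.
  by rewrite -natrD ltr_nat; lia.
have dlt i : ((Num.trunc (nrm (p i - y))).+1 < a.*2.+3)%N.
  by rewrite ltnS truncn_lt_nat ?nrm_ge0.
exists [ffun i => Ordinal (dlt i)].
  move=> i; rewrite ffunE /= mem_lball intvecB ?floorv_int //=.
    by rewrite ltW // truncnS_gt.
  by have := pb i; rewrite mem_lball => /andP[].
(* By the parallel axis identity, rounding the centroid adds at most [1] to the mean square, and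
   [rho^2 + 1 <= (rho + 1)^2]. *)
have sumsq : \sum_i nrm (p i - y) ^+ 2 <= L%:R * (rho + 1) ^+ 2.
  rewrite -(ler_pM2l np) mulr_sumr.
  have -> : \sum_i n%:R * nrm (p i - y) ^+ 2 = \sum_(x <- s) sqnorm (x - y).
    by rewrite /s big_map big_enum; apply: eq_bigr => i _; rewrite -sqnormE.
  rewrite sum_sqnorm_centroid ss // sqnormE //.
  have h1 : L%:R * (n%:R * nrm (centroid s - y) ^+ 2) <= L%:R * n%:R.
    by rewrite ler_pM2l // ger_pMr // expr_le1 ?nrm_ge0.
  apply: le_trans (lerD hs h1) _.
  have : 0 <= rho * (n%:R * L%:R) by rewrite !mulr_ge0.
  by rewrite sqrrD; lra.
have sumd : \sum_i nrm (p i - y) <= L%:R * (rho + 1).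
  by apply: sum_le_of_sum_sqr => //; lra.
(* AM-GM is applied to [(d i).+1], the truncated distance plus two. The distances have mean at most
   [rho + 1], whence [rho + 3]. *)
have := leif_AGM (A := 'I_L) (E := fun i => (Num.trunc (nrm (p i - y))).+2%:R : R)
  (fun i _ => ler0n _ _).
move=> [h _]; rewrite cardT size_enum_ord in h.
under eq_bigr do rewrite ffunE /=.
apply: le_trans h _; rewrite lerXn2r ?nnegrE ?addr_ge0 ?divr_ge0 ?sumr_ge0 //.
rewrite ler_pdivrMr //.
apply: (@le_trans _ _ (\sum_i (nrm (p i - y) + 2))).
  apply: ler_sum => i _; rewrite -addn2 natrD lerD2r truncn_le nrm_ge0 //.
by rewrite big_split /= sumr_const card_ord -mulr_natl; move: sumd; lra.
Qed.

(** A bad event is a centre [y] with rounded distances [d], confining codeword [i] to the ball of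
    radius [d i] about [y]. The middle factor of the hypothesis counts these events; the probability
    of each is at most [((rho + 3) / a.-1) ^ (n L)]. *)
Lemma exists_random_code (a L M : nat) (rho : R) : (0 < L)%N -> 0 <= rho -> (1 < a)%N ->
  M%:R ^+ L * ((size (lball R n a.+1))%:R * a.*2.+3%:R ^+ L) * ((rho + 3) ^+ L) ^+ n <
    (a.-1%:R ^+ L) ^+ n ->
  exists2 c : 'I_M -> 'rV[R]_n, (forall j, c j \in lball R n a) &
  forall tau : {ffun 'I_L -> 'I_M}, injective tau ->
    n%:R * rho ^+ 2 < avg_sq_rad [seq c (tau i) | i <- enum 'I_L].
Proof.
move=> L0 rho0 a1 hM.
pose pt (t : 'I_(size (lball R n a))) := nth 0 (lball R n a) t.
have ptb t : pt t \in lball R n a by apply: mem_nth.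
have pt_inj : injective pt.
  by move=> t u /eqP; rewrite nth_uniq ?lball_uniq // => /eqP /val_inj.
pose E := ('I_(size (lball R n a.+1)) * {ffun 'I_L -> 'I_(a.*2.+3)})%type.
pose good (d : {ffun 'I_L -> 'I_(a.*2.+3)}) := \prod_i (d i).+1%:R <= (rho + 3) ^+ L.
pose A (e : E) (i : 'I_L) : {set 'I_(size (lball R n a))} :=
  [set t | good e.2 & pt t - nth 0 (lball R n a.+1) e.1 \in lball R n (e.2 i)].
have cardA e i : (#|A e i| <= size (lball R n (e.2 i)))%N.
  rewrite cardE -(size_map (fun t => pt t - nth 0 (lball R n a.+1) e.1)).
  apply: uniq_leq_size.
    by rewrite map_inj_uniq ?enum_uniq // => t u /addIr /pt_inj.
  by move=> z /mapP[t]; rewrite mem_enum inE => /andP[_ h] ->.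
have ap : (0 : R) < a.-1%:R by rewrite ltr0n; lia.
set f := size (lball R n a).
have fp : (0 : R) < f%:R by rewrite ltr0n size_lball_gt0.
(* [size_lball_ratio] bounds [#|A e i| / f] by the [n]-th power of [(e.2 i).+1 / a.-1], and [good]
   controls the product over [i]. When [good] fails, the sets are empty. *)
have prodA (e : E) : (\prod_i #|A e i|)%:R * (a.-1%:R ^+ L) ^+ n <=
    ((rho + 3) ^+ L) ^+ n * f%:R ^+ L :> R.
  have [ge|/negbTE ge] := boolP (good e.2); last first.
    rewrite (_ : \prod_i _ = 0)%N ?mul0r.
      by rewrite mulr_ge0 ?exprn_ge0 ?addr_ge0.
    by rewrite (bigD1 (Ordinal L0)) //= eq_card0 // => t; rewrite inE ge.
  apply: (@le_trans _ _ ((\prod_i (e.2 i).+1%:R) ^+ n * f%:R ^+ L)); last first.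
    by rewrite ler_wpM2r ?exprn_ge0 // lerXn2r ?nnegrE ?exprn_ge0 ?addr_ge0 ?prodr_ge0.
  rewrite natr_prod -exprM mulnC exprM.
  rewrite -[L in _ ^+ L]card_ord -prodr_const -prodrXl -[f%:R ^+ L](_ : \prod_(i < L) f%:R = _);
    last by rewrite prodr_const card_ord.
  rewrite -!big_split /=; apply: ler_prod => i _; rewrite mulr_ge0 ?exprn_ge0 //=.
  apply: (@le_trans _ _ ((size (lball R n (e.2 i)))%:R * a.-1%:R ^+ n)).
    by rewrite ler_wpM2r ?exprn_ge0 // ler_nat.
  have := @size_lball_ratio R n (e.2 i).+1 a.-1 isT.
  rewrite prednK ?(ltnW a1) // -ltnS prednK ?(ltnW a1) // => /(_ a1).
  by rewrite -(ler_nat R) !natrM !natrX mulrC.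
have [|c hc] := @exists_avoiding_ffun _ _ M L A L0.
  rewrite card_ord -(ltr_nat R) natrM !natrX natr_sum.
  rewrite -(@ltr_pM2r _ ((a.-1%:R ^+ L) ^+ n)) ?exprn_gt0 // -mulrA mulr_suml.
  apply: (@le_lt_trans _ _ (M%:R ^+ L *
      \sum_(e : E) (((rho + 3) ^+ L) ^+ n * f%:R ^+ L))).
    by rewrite ler_wpM2l ?exprn_ge0 //; apply: ler_sum => e _; apply: prodA.
  rewrite sumr_const card_prod card_ffun !card_ord -[X in _ * X]mulr_natl natrM natrX.
  rewrite [ltRHS]mulrC -/f [X in X < _](_ : _ =
    (M%:R ^+ L * ((size (lball R n a.+1))%:R * a.*2.+3%:R ^+ L) *
      ((rho + 3) ^+ L) ^+ n) * f%:R ^+ L); last by rewrite !mulrA.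
  by rewrite ltr_pM2r // exprn_gt0.
exists (pt \o c) => [j|tau ti]; first exact: ptb.
rewrite ltNge; apply/negP => hbad.
have [y yb [d db dp]] := bad_list_quantize L0 rho0 (fun i => ptb (c (tau i))) hbad.
have yi : (index y (lball R n a.+1) < size (lball R n a.+1))%N by rewrite index_mem.
have [i] := hc tau ti (Ordinal yi, d).
by rewrite inE /good dp /= nth_index // db.
Qed.

(** Random codewords may coincide. Removing duplicates leaves at least [M / L] points, since no
    point occurs more than [L] times. *)
Lemma exists_LD_code (a L M : nat) (rho : R) : (0 < L)%N -> 0 <= rho -> (1 < a)%N ->
  M%:R ^+ L * ((size (lball R n a.+1))%:R * a.*2.+3%:R ^+ L) * ((rho + 3) ^+ L) ^+ n <
    (a.-1%:R ^+ L) ^+ n ->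
  exists2 C : seq 'rV[R]_n, avg_rad_LD_code (a%:R ^+ 2) (rho ^+ 2) L C &
    (M <= L * size C)%N.
Proof.
move=> L0 rho0 a1 hM; have [c cb hc] := exists_random_code L0 rho0 a1 hM.
set X := [seq c j | j <- enum 'I_M]; exists (undup X).
  split; first exact: undup_uniq.
  split=> [x|s us ss sX].
    rewrite mem_undup => /mapP[j _ ->].
    have := cb j; rewrite mem_lball => /andP[_ h].
    by rewrite sqnormE // ler_wpM2l // lerXn2r ?nnegrE ?nrm_ge0.
  have sj i : exists j, c j == nth 0 s (i : 'I_L).
    have : nth 0 s i \in X by rewrite -mem_undup; apply: sX; rewrite mem_nth ?ss.
    by move=> /mapP[j _ ->]; exists j.
  pose tau := [ffun i : 'I_L => xchoose (sj i)].
  have ctau i : c (tau i) = nth 0 s i by rewrite ffunE (eqP (xchooseP (sj i))).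
  have ti : injective tau.
    move=> i j /(congr1 c); rewrite !ctau => /eqP; rewrite nth_uniq ?ss //.
    by move=> /eqP /val_inj.
  have -> : s = [seq c (tau i) | i <- enum 'I_L].
    have sE : size [seq c (tau i) | i <- enum 'I_L] = L by rewrite size_map size_enum_ord.
    apply: (@eq_from_nth _ 0) => [|i]; rewrite ss ?sE // => iL.
    rewrite (nth_map (Ordinal iL)) ?size_enum_ord // ctau; congr nth.
    by rewrite nth_enum_ord.
  exact: hc.
(* A point of multiplicity [L] would give a list of average radius [0]. *)
have mult x : (count_mem x X <= L)%N.
  rewrite leqNgt; apply/negP => h.
  have hL : (L <= #|[pred j | c j == x]|)%N.
    suff <- : count_mem x X = #|[pred j | c j == x]| by apply: ltnW.
    by rewrite count_map -sum1_count big_enum_cond -sum1_card.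
  pose tau := [ffun i : 'I_L => enum_val (widen_ord hL i)].
  have ti : injective tau.
    by move=> i j; rewrite !ffunE => /enum_val_inj/(congr1 val)/= /val_inj.
  have := hc tau ti; rewrite ltNge => /negP; apply.
  apply: (@le_trans _ _ 0); last by rewrite mulr_ge0 ?sqr_ge0.
  apply: (avg_sq_rad_le (y := x)); first by rewrite size_map size_enum_ord.
  move=> z /mapP[i _ ->]; have /eqP -> : c (tau i) == x.
    by rewrite ffunE; have := enum_valP (widen_ord hL i); rewrite inE.
  by rewrite subrr sqnorm0.
have -> : M = size X by rewrite size_map size_enum_ord.
have -> : size X = (\sum_(x <- undup X) count_mem x X)%N.
  rewrite -[LHS]sum1_size -big_undup_iterop_count; apply: eq_bigr => x _.
  by rewrite Monoid.iteropE iter_addn_0 mul1n.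
have -> : (L * size (undup X) = \sum_(x <- undup X) L)%N.
  by rewrite big_const_seq iter_addn_0 count_predT.
by apply: leq_sum.
Qed.

End RandomCode.

(** * Exponential bounds on code sizes, with the radii chosen *)

Section ExponentialBounds.
Variable R : realType.
Implicit Types (P N kappa gamma eps : R).

Lemma trunc_succ_ge (x : R) : exists2 a : nat, (0 < a)%N & x <= a%:R.
Proof. by exists (Num.trunc x).+1 => //; apply/ltW/truncnS_gt. Qed.

(** The radii are fixed large integers with [b / a] slightly above [kappa], which leaves room below
    [sqrt (N / P)] for the error terms of [size_code_le]. *)
Lemma size_code_expn P N kappa (L : nat) : 0 < N -> N < P -> (0 < L)%N ->
  0 < kappa -> kappa ^+ 2 < N / P ->
  exists n1 : nat, forall n, (n1 <= n)%N -> forall C : seq 'rV[R]_n,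
    avg_rad_LD_code P N L C -> (size C)%:R * kappa ^+ n <= (2 * L)%:R.
Proof.
move=> N0 NP L0 k0 kb; have P0 : 0 < P by apply: lt_trans NP.
have PN0 : 0 < P - N by rewrite subr_gt0.
have PNn : P - N != 0 by rewrite gt_eqF.
have Pn : P != 0 by rewrite gt_eqF.
pose alpha := (P - N) / P; pose beta := N / P; pose s := Num.sqrt (N / (P - N)).
have al0 : 0 < alpha by rewrite divr_gt0.
have be0 : 0 <= beta by rewrite divr_ge0 ?ltW.
have be1 : beta < 1 by rewrite ltr_pdivrMr // mul1r.
have ab : alpha + beta = 1 by rewrite /alpha /beta; field.
have s0 : 0 < s by rewrite sqrtr_gt0 divr_gt0.
have s2 : s ^+ 2 = N / (P - N) by rewrite sqr_sqrtr // divr_ge0 // ltW.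
have k1 : kappa < 1.
  by rewrite -(@ltr_pXn2r _ 2) ?nnegrE ?(ltW k0) // expr1n (lt_trans kb).
have d0 : 0 < beta - kappa ^+ 2 by rewrite subr_gt0.
(* After multiplication by [a]: [15 a] covers the rounding in [b^2], [3 a] covers [2 a + 1], and
   [2 s a] is [2 r]. The summand [s^-1] ensures [1 <= r]. *)
have [a a0 ha] := trunc_succ_ge ((18 + 2 * s) / (beta - kappa ^+ 2) + s^-1).
have ap : 0 < a%:R :> R by rewrite ltr0n.
have a1 : 1 <= a%:R :> R by rewrite ler1n.
have ha1 : 18 + 2 * s <= (beta - kappa ^+ 2) * a%:R.
  by rewrite [leRHS]mulrC -ler_pdivrMr //; apply: le_trans ha; rewrite lerDl invr_ge0 ltW.
have r1 : 1 <= a%:R * s.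
  rewrite -ler_pdivrMr // mul1r; apply: le_trans ha; rewrite lerDr.
  by rewrite divr_ge0 ?(ltW d0) // addr_ge0 // mulr_ge0 // ltW.
(* The offset gives [kappa * a.+1 <= b.-1], the two radii that [size_lball_ratio] compares. *)
pose b := (Num.trunc (kappa * a.+1%:R)).+2.
have bl : kappa * a.+1%:R <= b.-1%:R by apply/ltW/truncnS_gt.
have bu : b%:R <= kappa * a%:R + 3.
  have : (Num.trunc (kappa * a.+1%:R))%:R <= kappa * a.+1%:R.
    by rewrite truncn_le mulr_ge0 // ltW.
  by rewrite /b -addn2 natrD -[a.+1]addn1 natrD; lra.
have ka : kappa * a%:R <= a%:R by rewrite ger_pMl // ltW.
have b2 : b%:R ^+ 2 <= kappa ^+ 2 * a%:R ^+ 2 + 15 * a%:R.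
  apply: (@le_trans _ _ ((kappa * a%:R + 3) ^+ 2)).
    by rewrite lerXn2r ?nnegrE ?addr_ge0 ?mulr_ge0 // ltW.
  by rewrite sqrrD exprMn; lra.
have ba : (18 + 2 * s) * a%:R <= beta * a%:R ^+ 2 - kappa ^+ 2 * a%:R ^+ 2.
  by rewrite -mulrBl expr2 mulrA ler_pM2r.
have sa : 0 <= s * a%:R by rewrite mulr_ge0 // ltW.
have [n1 n10 hn1] := trunc_succ_ge (2 * (a%:R ^+ 2 / alpha) * b%:R ^+ 2).
exists n1 => n n1n C CC; have n0 : (0 < n)%N by apply: leq_trans n1n.
pose c := a%:R / Num.sqrt (P - N).
have cE : c ^+ 2 = a%:R ^+ 2 / (P - N) by rewrite exprMn exprVn sqr_sqrtr // ltW.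
have c0 : c != 0 by rewrite gt_eqF // divr_gt0 // sqrtr_gt0.
have CC' := avg_rad_LD_codeZ c0 CC.
have hC : (size C * size (lball R n b) <= 2 * L * size (lball R n a))%N.
  rewrite -[size C](size_map (fun x => c *: x)).
  apply: (size_code_le (r := a%:R * s) n0 L0 al0 be0 ab _ r1 a0 _ _ _ _ _ CC').
  - by rewrite exprMn s2 /alpha /beta; field; rewrite Pn PNn.
  - by move: b2 ba sa a1; lra.
  - by move: b2 ba sa a1; lra.
  - by apply: le_trans hn1 _; rewrite ler_nat.
  - by rewrite cE /alpha; field; rewrite Pn PNn.
  - by rewrite cE exprMn s2; field.
have hr : (b.-1 ^ n * size (lball R n a) <= a.+1 ^ n * size (lball R n b))%N :=
  @size_lball_ratio R n a.+1 b.-1 isT isT.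
have fb : 0 < (size (lball R n b))%:R :> R by rewrite ltr0n size_lball_gt0.
have h1 : ((size C) * b.-1 ^ n <= 2 * L * a.+1 ^ n)%N.
  rewrite -(leq_pmul2r (size_lball_gt0 R n b)).
  rewrite mulnAC (leq_trans (leq_mul hC (leqnn _))) // -[leqLHS]mulnA -[leqRHS]mulnA.
  by rewrite leq_mul2l [X in _ || (X <= _)%N]mulnC hr orbT.
have := h1; rewrite -(ler_nat R) !natrM !natrX => h2.
have a1n : 0 < a.+1%:R ^+ n :> R by rewrite exprn_gt0.
rewrite -(ler_pM2r a1n) -[leLHS]mulrA -exprMn; apply: le_trans h2.
by rewrite ler_wpM2l // lerXn2r ?nnegrE ?mulr_ge0 // ltW.
Qed.

Lemma expn_unbounded (q x : R) : 1 < q -> exists l0 : nat, forall l, (l0 <= l)%N -> x <= q ^+ l.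
Proof.
move=> q1; have lq : 0 < ln q by rewrite ln_gt0.
have [l0 _ hl] := trunc_succ_ge (ln x / ln q); exists l0 => l ll.
have q0 : 0 < q by apply: lt_trans q1.
have [x0|x0] := lerP x 0; first by rewrite (le_trans x0) // exprn_ge0 // ltW.
rewrite -ler_ln ?posrE ?exprn_gt0 // lnXn // -mulr_natl -ler_pdivrMr //.
by apply: le_trans hl _; rewrite ler_nat.
Qed.

(** There are at most [K0 ^ n] rounded centres, with [K0] independent of [L], while the gap between
    [sqrt (N / P)] and [gamma] gains a factor exponential in [n L]; so large [L] wins. *)
Lemma exists_code_expn P N gamma : 0 < P -> 0 < N -> 0 < gamma -> N / P < gamma ^+ 2 ->
  exists L0 : nat, forall L, (L0 <= L)%N -> (0 < L)%N -> exists2 K : R, 1 <= K &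
    forall n, (0 < n)%N -> exists2 C : seq 'rV[R]_n, avg_rad_LD_code P N L C &
      (gamma ^+ n)^-1 <= K * (L%:R * (size C)%:R + 1).
Proof.
move=> P0 N0 g0 hg; set kappa := Num.sqrt (N / P).
have NP0 : 0 < N / P by rewrite divr_gt0.
have k2 : kappa ^+ 2 = N / P by rewrite sqr_sqrtr // ltW.
have k0 : 0 <= kappa by rewrite sqrtr_ge0.
have kg : kappa < gamma by rewrite -(@ltr_pXn2r _ 2) ?nnegrE ?(ltW g0) // k2.
(* The gap from [kappa] to [g1] absorbs the shifts in [kappa a + 3] and [a - 1]; the factor
   [gamma / g1] pays for the centres. *)
pose g1 := (kappa + gamma) / 2.
have g1k : kappa < g1 by rewrite /g1; lra.
have g1g : g1 < gamma by rewrite /g1; lra.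
have g10 : 0 < g1 by apply: le_lt_trans g1k.
have [a' _ ha'] := trunc_succ_ge ((3 + g1) / (g1 - kappa)).
pose a := a'.+2; have a1 : (1 < a)%N by [].
have ha : kappa * a%:R + 3 <= g1 * a.-1%:R.
  have : 3 + g1 <= a%:R * (g1 - kappa).
    rewrite -ler_pdivrMr ?subr_gt0 //; apply: le_trans ha' _.
    by rewrite ler_nat /a; lia.
  have -> : a%:R = a.-1%:R + 1 :> R by rewrite natr1.
  by lra.
pose K0 := (3 * 2 ^ (a.+1 ^ 2))%N.
have [L0 hL] := @expn_unbounded (gamma / g1) K0%:R ltac:(by rewrite ltr_pdivlMr ?mul1r).
exists L0 => L L0L Lp; exists a.*2.+4%:R; first by rewrite ler1n.
(* Dividing by [a.*2.+4] rather than [a.*2.+3] makes [Mlt] strict. *)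
move=> n n0; pose M := Num.trunc ((gamma ^+ n)^-1 / a.*2.+4%:R).
have gn : 0 < gamma ^+ n by rewrite exprn_gt0.
have Ap : 0 < a.*2.+4%:R :> R by rewrite ltr0n.
have Mle : M%:R * a.*2.+4%:R <= (gamma ^+ n)^-1.
  by rewrite -ler_pdivlMr // truncn_le mulr_ge0 ?invr_ge0 ?ltW.
have Mlt : M%:R * a.*2.+3%:R * gamma ^+ n < 1.
  rewrite -ltr_pdivlMr // mul1r; have [->|M0] := posnP M.
    by rewrite mul0r invr_gt0.
  by apply: lt_le_trans Mle; rewrite ltr_pM2l ?ltr0n // ltr_nat.
have ap : 0 < a.-1%:R :> R by [].
have q0 : 0 <= gamma / g1 by rewrite divr_ge0 // ltW.
have hsz : (size (lball R n a.+1))%:R <= ((gamma / g1) ^+ L) ^+ n.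
  apply: (@le_trans _ _ (K0%:R ^+ n)).
    by rewrite -natrX ler_nat size_lball_le.
  by rewrite lerXn2r ?nnegrE ?exprn_ge0 ?hL.
have hka : ((kappa * a%:R + 3) ^+ L) ^+ n <= ((g1 * a.-1%:R) ^+ L) ^+ n.
  have h0 : 0 <= kappa * a%:R + 3 by rewrite addr_ge0 ?mulr_ge0.
  have h1 : 0 <= g1 * a.-1%:R by rewrite mulr_ge0 // ltW.
  by rewrite !lerXn2r ?nnegrE ?exprn_ge0.
have hM : M%:R ^+ L * ((size (lball R n a.+1))%:R * a.*2.+3%:R ^+ L) *
    ((kappa * a%:R + 3) ^+ L) ^+ n < (a.-1%:R ^+ L) ^+ n.
  have qn : 0 <= M%:R ^+ L * ((gamma / g1) ^+ L ^+ n * a.*2.+3%:R ^+ L) :> R.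
    by rewrite !mulr_ge0 ?exprn_ge0.
  apply: (@le_lt_trans _ _ (M%:R ^+ L * ((gamma / g1) ^+ L ^+ n * a.*2.+3%:R ^+ L) *
      ((g1 * a.-1%:R) ^+ L) ^+ n)).
    apply: ler_pM hka; first by rewrite !mulr_ge0 ?exprn_ge0.
      by rewrite exprn_ge0 // exprn_ge0 // addr_ge0 // mulr_ge0.
    by rewrite ler_wpM2l ?exprn_ge0 // ler_wpM2r ?exprn_ge0.
  have -> : M%:R ^+ L * ((gamma / g1) ^+ L ^+ n * a.*2.+3%:R ^+ L) *
      ((g1 * a.-1%:R) ^+ L) ^+ n =
      (M%:R * a.*2.+3%:R * gamma ^+ n) ^+ L * (a.-1%:R ^+ L) ^+ n :> R.
    rewrite -[in RHS](divfK (_ : g1 != 0) gamma) ?gt_eqF // !exprMn.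
    by rewrite -![_ ^+ n ^+ L]exprAC; ring.
  rewrite gtr_pMl ?exprn_gt0 // expr_lt1 // !mulr_ge0 // ltW //.
have [C CC MC] := exists_LD_code n0 Lp (mulr_ge0 k0 (ler0n _ a)) a1 hM.
pose c := Num.sqrt P / a%:R.
have an : a%:R != 0 :> R by rewrite pnatr_eq0.
have c0 : c != 0 by rewrite mulf_neq0 ?invr_eq0 // gt_eqF // sqrtr_gt0.
have cE : c ^+ 2 = P / a%:R ^+ 2 by rewrite exprMn exprVn sqr_sqrtr // ltW.
have := avg_rad_LD_codeZ c0 CC.
have -> : c ^+ 2 * a%:R ^+ 2 = P by rewrite cE divfK // sqrf_eq0.
have -> : c ^+ 2 * (kappa * a%:R) ^+ 2 = N.
  by rewrite cE exprMn k2; field; rewrite an gt_eqF.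
move=> CC'; exists [seq c *: x | x <- C] => //; rewrite size_map mulrC -ler_pdivrMr //.
apply: le_trans (ltW (truncnS_gt _)) _; rewrite -natr1 lerD2r -natrM ler_nat.
exact: MC.
Qed.

End ExponentialBounds.

Local Open Scope classical_set_scope.
Local Open Scope ring_scope.

(** * From code sizes to rates and the capacity *)

Section Capacity.
Variable R : realType.
Implicit Types (P N eps : R).

Lemma ln_div_eventually_le (x eps : R) : 0 < eps ->
  exists n1 : nat, forall n, (n1 <= n)%N -> (0 < n)%N /\ x / n%:R <= eps.
Proof.
move=> e0; have [n1 n10 hn] := trunc_succ_ge (x / eps).
exists n1 => n nn; have n0 : (0 < n)%N by apply: leq_trans nn.
split=> //; rewrite ler_pdivrMr ?ltr0n // mulrC -ler_pdivrMr //.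
by apply: le_trans hn _; rewrite ler_nat.
Qed.

Lemma rate_le_max P N eps (L : nat) : 0 < P -> 0 < N -> (0 < L)%N -> 0 < eps ->
  exists n1 : nat, forall n, (n1 <= n)%N -> forall C : seq 'rV[R]_n,
    avg_rad_LD_code P N L C -> rate C <= Num.max 0 (2^-1 * ln (P / N)) + eps.
Proof.
move=> P0 N0 L0 e0; set v := 2^-1 * ln (P / N).
have max0 : 0 <= Num.max 0 v by rewrite le_max lexx.
have [PN|NP] := lerP P N.
  have [n1 h] := ln_div_eventually_le (ln L%:R) e0.
  exists n1 => n /h[n0 hn] C /(size_code_lt L0 PN) CL.
  apply: (@le_trans _ _ eps); last by rewrite lerDr.
  apply: le_trans hn; rewrite /rate ler_wpM2r ?invr_ge0 //.
  have [->|C0] := posnP (size C); first by rewrite ln0 // ln_ge0 // ler1n.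
  by rewrite ler_ln ?posrE ?ltr0n // ler_nat ltnW.
(* Half of [eps] puts [kappa] below [sqrt (N / P)]; the other half absorbs [ln (2 L) / n]. *)
pose kappa := expR (- (v + eps / 2)).
have k0 : 0 < kappa by rewrite expR_gt0.
have kb : kappa ^+ 2 < N / P.
  rewrite -ltr_ln ?posrE ?exprn_gt0 ?divr_gt0 // lnXn // expRK -[_ *+ 2]mulr_natl.
  rewrite -[N / P]invf_div lnV ?posrE ?divr_gt0 // /v; lra.
have [n1 h1] := size_code_expn N0 NP L0 k0 kb.
have e2 : 0 < eps / 2 by rewrite divr_gt0.
have [n2 h2] := ln_div_eventually_le (ln (2 * L)%:R) e2.
exists (maxn n1 n2) => n; rewrite geq_max => /andP[nn1 /h2[n0 hn]] C CC.
have np : 0 < n%:R :> R by rewrite ltr0n.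
have [C0|C0] := posnP (size C).
  by rewrite /rate C0 ln0 // mul0r addr_ge0 // ltW.
have Cp : 0 < (size C)%:R :> R by rewrite ltr0n.
have := h1 n nn1 C CC.
rewrite -ler_ln ?posrE ?mulr_gt0 ?exprn_gt0 ?ltr0n ?muln_gt0 //.
rewrite lnM ?posrE ?exprn_gt0 // lnXn // expRK -[_ *+ n]mulr_natl => h.
have hv : v <= Num.max 0 v by rewrite le_max lexx orbT.
apply: (@le_trans _ _ (v + eps)); last by rewrite lerD2r.
rewrite /rate ler_pdivrMr //; move: hn; rewrite ler_pdivrMr // => hn.
have : n%:R * (v + eps / 2) + eps / 2 * n%:R = (v + eps) * n%:R by field.
by lra.
Qed.

Lemma empty_code P N (L n : nat) : (0 < L)%N -> avg_rad_LD_code P N L ([::] : seq 'rV[R]_n).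
Proof.
move=> L0; split=> //; split=> // s us ss sC.
case: s ss us sC => [ss|x s _ _ /(_ x)]; first by rewrite -ss in L0.
by rewrite inE eqxx => /(_ isT).
Qed.

Lemma exists_code_rate_ge P N eps : 0 < P -> 0 < N -> 0 < eps ->
  exists L0 : nat, forall L, (L0 <= L)%N -> (0 < L)%N ->
    exists n1 : nat, forall n, (n1 <= n)%N ->
      exists2 C : seq 'rV[R]_n, avg_rad_LD_code P N L C &
        Num.max 0 (2^-1 * ln (P / N)) - eps <= rate C.
Proof.
move=> P0 N0 e0; set v := 2^-1 * ln (P / N).
(* In this case and the next the target is at most [0], the rate of the empty code. *)
have [v0|v0] := lerP v 0.
  exists 0%N => L _ L0; exists 0%N => n _; exists [::]; first exact: empty_code.
  by rewrite sub0r /rate ln0 // mul0r oppr_le0 ltW.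
have [ve|ve] := lerP v eps.
  exists 0%N => L _ L0; exists 0%N => n _; exists [::]; first exact: empty_code.
  by rewrite /rate ln0 // mul0r subr_le0.
pose gamma := expR (- (v - eps / 2)).
have g0 : 0 < gamma by rewrite expR_gt0.
have gb : N / P < gamma ^+ 2.
  rewrite -ltr_ln ?posrE ?exprn_gt0 ?divr_gt0 // lnXn // expRK -[_ *+ 2]mulr_natl.
  rewrite -[N / P]invf_div lnV ?posrE ?divr_gt0 // /v; lra.
have [L0 hL] := exists_code_expn P0 N0 g0 gb.
exists L0 => L LL Lp; have [K K1 hK] := hL L LL Lp.
have Kp : 0 < K by apply: lt_le_trans K1.
have KL : 0 < K * (L%:R + 1) by rewrite mulr_gt0 // ltr_wpDl.
have e4 : 0 < eps / 4 by rewrite divr_gt0.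
have [n1 h1] := ln_div_eventually_le (ln (K * (L%:R + 1))) e4.
exists n1 => n /h1[n0 hn]; have np : 0 < n%:R :> R by rewrite ltr0n.
have [C CC hC] := hK n n0; exists C => //.
move: hn; rewrite ler_pdivrMr // => hn.
have en : eps * n%:R <= v * n%:R by rewrite ler_pM2r // ltW.
have enp : 0 < eps * n%:R by rewrite mulr_gt0.
have gE : ln (gamma ^+ n)^-1 = n%:R * (v - eps / 2).
  by rewrite lnV ?posrE ?exprn_gt0 // lnXn // expRK -[_ *+ n]mulr_natl mulrN opprK.
have gnp : 0 < (gamma ^+ n)^-1 by rewrite invr_gt0 exprn_gt0.
(* An empty code would give [v - eps / 2 <= eps / 4], against [eps < v]. *)
have C0 : (0 < size C)%N.
  rewrite lt0n; apply/negP => /eqP C0.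
  move: hC; rewrite C0 mulr0 add0r mulr1 => hC.
  have : (gamma ^+ n)^-1 <= K * (L%:R + 1).
    by apply: le_trans hC _; rewrite ler_peMr ?(ltW Kp) // lerDr.
  by rewrite -ler_ln ?posrE // gE; lra.
have Cp : 0 < (size C)%:R :> R by rewrite ltr0n.
have : (gamma ^+ n)^-1 <= K * (L%:R + 1) * (size C)%:R.
  apply: le_trans hC _; rewrite -mulrA ler_pM2l // mulrDl lerD2l mul1r ler1n //.
rewrite -ler_ln ?posrE ?mulr_gt0 // gE lnM ?posrE // => h.
rewrite /rate ler_pdivlMr //; lra.
Qed.

(** The upper limit is an infimum of suprema over neighbourhoods of infinity, so a single tail
    suffices. *)
Lemma capacity_le P N (L : nat) : 0 < P -> 0 < N -> (0 < L)%N ->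
  (avg_rad_LD_capacity P N L <= (Num.max 0 (2^-1 * ln (P / N)))%:E)%E.
Proof.
move=> P0 N0 L0; apply/lee_addgt0Pr => eps e0.
have [n1 h] := rate_le_max P0 N0 L0 e0.
rewrite /avg_rad_LD_capacity /limn_esup /limf_esup; apply: ge_ereal_inf.
exists (ereal_sup [set best_rate P N L n | n in [set n | (n1 <= n)%N]]).
  by exists [set n | (n1 <= n)%N] => //; exists n1.
apply: ge_ereal_sup => _ [n /= nn <-]; apply: ge_ereal_sup => _ [C /= CC <-].
by rewrite -EFinD lee_fin h.
Qed.

(** Every neighbourhood of infinity contains some [n >= n1], where a good code exists. *)
Lemma capacity_ge P N eps : 0 < P -> 0 < N -> 0 < eps ->
  exists L0 : nat, forall L, (L0 <= L)%N ->
    ((Num.max 0 (2^-1 * ln (P / N)) - eps)%:E <= avg_rad_LD_capacity P N L)%E.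
Proof.
move=> P0 N0 e0; have [L0 hL] := exists_code_rate_ge P0 N0 e0.
exists L0.+1 => L LL; have [n1 h] := hL L (ltnW LL) (leq_ltn_trans (leq0n _) LL).
rewrite /avg_rad_LD_capacity /limn_esup /limf_esup; apply: le_ereal_inf_tmp.
move=> _ [V [n2 _ hV] <-].
have [C CC hC] := h (maxn n1 n2) (leq_maxl _ _).
apply: (@le_trans _ _ (best_rate P N L (maxn n1 n2))); last first.
  by apply: ereal_sup_ubound; exists (maxn n1 n2) => //; apply: hV; rewrite /= leq_maxr.
apply: (@le_trans _ _ (rate C)%:E); first by rewrite lee_fin.
by apply: ereal_sup_ubound; exists C.
Qed.

End Capacity.

(* The positive part matters only for [P < N]: the empty code is list-decodable and has rate
   [0] ([ln 0 = 0] here), so the capacity is never negative. *)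
Theorem mainTheorem1 (R : realType) (P N : R) (hP : 0 < P) (hN : 0 < N) :
  (fun L : nat => avg_rad_LD_capacity P N L) @ \oo
    --> (Num.max 0 (2^-1 * ln (P / N)))%:E.
Proof.
set v := Num.max 0 _ => A /= [eps /= e0 hA].
have e2 : 0 < eps / 2 by rewrite divr_gt0.
have [L0 hL] := capacity_ge hP hN e2.
exists L0.+1 => // L /= LL.
have h1 := hL L (ltnW LL).
have h2 := capacity_le hP hN (leq_ltn_trans (leq0n _) LL).
(* The two bounds rule out infinite values. *)
move: h1 h2; rewrite -/v; case: (avg_rad_LD_capacity P N L) => [c| |] //.
rewrite !lee_fin => h1 h2; apply: hA => /=.
by rewrite ger0_norm ?subr_ge0 //; lra.
Qed.
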